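(* There is a family of $2^{\aleph_0}$ nonpathological and pairwise nonisomorphic tall density-like ideals on $\omega$, none of which is a generalized density ideal.
   Context: $\omega=\{0,1,2,\dots\}$, and each $n\in\omega$ is identified with $\{0,\dots,n-1\}$. An ideal on $\omega$ is a family of subsets of $\omega$ closed under subsets and finite unions; all ideals are assumed to contain every finite subset of $\omega$ and not to contain $\omega$. An ideal $\mathcal{I}$ is tall if every infinite $A\subseteq\omega$ contains an infinite subset belonging to $\mathcal{I}$. Ideals $\mathcal{I},\mathcal{J}$ on $\omega$ are isomorphic if there is a bijection $f:\omega\to\omega$ such that, for all $A\subseteq\omega$, $A\in\mathcal{I}$ if and only if $f^{-1}[A]\in\mathcal{J}$. A lower semicontinuous submeasure (lscsm) on $\omega$ is a function $\varphi:\mathcal{P}(\omega)\to[0,\infty]$ that is monotone and subadditive, with $\varphi(\emptyset)=0$, $\varphi(\{n\})<\infty$ for all $n$, and $\varphi(A)=\lim_n\varphi(A\cap n)$ for all $A\subseteq\omega$. Its support is $\mathrm{supp}(\varphi)=\{n\in\omega:\varphi(\{n\})\neq 0\}$. Put $\|A\|_\varphi=\inf\{\varphi(A\setminus F): F\subseteq\omega\text{ finite}\}$ and $\mathrm{Exh}(\varphi)=\{A\subseteq\omega:\|A\|_\varphi=0\}$. A lscsm $\varphi$ is nonpathological if for every $A\subseteq\omega$, $\varphi(A)$ is the supremum of $\eta(A)$ over all finitely additive measures $\eta$ on $\mathcal{P}(\omega)$ with $\eta(V)\le\varphi(V)$ for all $V\subseteq\omega$. An ideal is nonpathological if it equals $\mathrm{Exh}(\varphi)$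 for some nonpathological lscsm $\varphi$. An ideal $\mathcal{I}$ is a generalized density ideal if $\mathcal{I}=\mathrm{Exh}(\sup_n\mu_n)$ (pointwise supremum) for some sequence $(\mu_n)_{n\in\omega}$ of lscsms with finite pairwise disjoint supports. A lscsm $\varphi$ is density-like if for all $\varepsilon>0$ there is $\delta>0$ such that, whenever $(F_n)_{n\in\omega}$ is a sequence of nonempty finite pairwise disjoint subsets of $\omega$ with $\varphi(F_n)<\delta$ for all $n$, there is an infinite $I\subseteq\omega$ with $\varphi(\bigcup_{i\in I}F_i)<\varepsilon$. An ideal $\mathcal{I}$ is density-like if $\mathcal{I}=\mathrm{Exh}(\varphi)$ for some density-like lscsm $\varphi$. *)

(* Defs.v *)
From mathcomp Require Import all_boot all_order all_algebra.
From mathcomp Require Import all_classical all_reals all_analysis.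

Set Implicit Arguments.
Unset Strict Implicit.
Unset Printing Implicit Defensive.

Import Order.TTheory GRing.Theory Num.Theory.
Import numFieldNormedType.Exports.

Local Open Scope classical_set_scope.
Local Open Scope ring_scope.
Local Open Scope ereal_scope.

Record is_ideal (I : set (set nat)) : Prop := {
  ideal_subset : forall A B, I B -> A `<=` B -> I A;
  ideal_setU : forall A B, I A -> I B -> I (A `|` B);
  ideal_finite : forall A, finite_set A -> I A;
  ideal_proper : ~ I [set: nat]
}.

Definition tall (I : set (set nat)) : Prop :=
  forall A, infinite_set A -> exists B, [/\ B `<=` A, infinite_set B & I B].

Definition isomorphic (I J : set (set nat)) : Prop :=
  exists2 f : nat -> nat, bijective f & forall A, I A <-> J (f @^-1` A).

(* Here `I_n = [set k | (k < n)%N] is the von Neumann natural number n. *)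
Record is_lscsm (R : realType) (phi : set nat -> \bar R) : Prop := {
  lscsm_ge0 : forall A, 0 <= phi A;
  lscsm_mono : forall A B, A `<=` B -> phi A <= phi B;
  lscsm_subadd : forall A B, phi (A `|` B) <= phi A + phi B;
  lscsm_set0 : phi set0 = 0;
  lscsm_fin1 : forall n, phi [set n] < +oo;
  lscsm_lsc : forall A, phi (A `&` `I_n) @[n --> \oo] --> phi A
}.

Definition supp (R : realType) (phi : set nat -> \bar R) : set nat :=
  [set n | phi [set n] <> 0].

Definition exh_norm (R : realType) (phi : set nat -> \bar R) (A : set nat) :
  \bar R := ereal_inf [set phi (A `\` F) | F in [set F | finite_set F]].

Definition Exh (R : realType) (phi : set nat -> \bar R) : set (set nat) :=
  [set A | exh_norm phi A = 0].

(* Every subset of nat is measurable in the library's structure on nat, so a  *)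
(* content on nat is a finitely additive [0, +oo]-valued measure on all of    *)
(* its powerset.                                                              *)
Definition nonpathological (R : realType) (phi : set nat -> \bar R) : Prop :=
  forall A, phi A = ereal_sup [set eta A | eta in
    [set eta : {content set nat -> \bar R} | forall V, eta V <= phi V]].

Definition nonpathological_ideal (R : realType) (I : set (set nat)) : Prop :=
  exists phi : set nat -> \bar R,
    [/\ is_lscsm phi, nonpathological phi & I = Exh phi].

Definition generalized_density_ideal (R : realType) (I : set (set nat)) :
  Prop :=
  exists mu : nat -> set nat -> \bar R,
    [/\ forall n, is_lscsm (mu n),
        forall n, finite_set (supp (mu n)),
        forall m n, m <> n -> supp (mu m) `&` supp (mu n) = set0 &
        I = Exh (fun A => ereal_sup [set mu n A | n in [set: nat]])].

Definition density_like (R : realType) (phi : set nat -> \bar R) : Prop :=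
  forall eps : R, (0 < eps)%R -> exists2 delta : R, (0 < delta)%R &
    forall F : nat -> set nat,
      (forall n, F n !=set0) ->
      (forall n, finite_set (F n)) ->
      (forall m n, m <> n -> F m `&` F n = set0) ->
      (forall n, phi (F n) < delta%:E) ->
      exists2 K : set nat, infinite_set K &
        phi (\bigcup_(i in K) F i) < eps%:E.

Definition density_like_ideal (R : realType) (I : set (set nat)) : Prop :=
  exists phi : set nat -> \bar R,
    [/\ is_lscsm phi, density_like phi & I = Exh phi].

(* Main.v *)
From HB Require Import structures.
Require Import Defs.
From mathcomp Require Import all_boot all_order all_algebra.
From mathcomp Require Import all_classical all_reals all_analysis.
From mathcomp Require Import lra zify.

(** Cut [nat] into consecutive intervals, the blocks, whose sizes grow so fast
    that each block is much larger than everything before it.  Let [dens k A]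
    be the proportion of the [k]-th block that lies in [A].  Spread blocks, by
    an injective coding [e], over an array of components: the component [N]
    has the columns [0, ..., N], and the column [i] of [N] is the infinite
    sequence of the blocks [e N i x].  The submeasure is
    [column_density e A = sup_N (1 / (N + 1)) sum_(i <= N) sup_x dens (e N i x) A].
    Choosing one block in each column of one component writes it as a supremum
    of finitely supported measures, so it is lower semicontinuous and
    nonpathological ([column_density_lscsm], [column_density_nonpathological]).
    Its ideal is tall because single points weigh less and less
    ([tall_Exh_column_density]).

    It is density-like ([density_like_column_density]): let finite disjoint
    sets [F k] have submeasure less than [d].  Along an ultrafilter the column
    densities of [F k] converge to limits [a N i], and each component has mean
    limit at most [2 d].  Choose a subsequence whose members occupy separated
    ranges of blocks, each member having column densities below [a N i + d] in
    every component met by the range of an earlier one.  In a component the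
    union then has, column by column, at most the density of the first member
    met plus [a N i + d], which averages to at most [4 d].

    It is not a generalized density ideal
    ([not_generalized_density_Exh_column_density]): if [mu n] were lscsms with
    finite disjoint supports defining the same ideal, then the two submeasures
    would control each other on finite sets far away ([Exh_comparison]).  One
    can choose a block in each column of the component [N] so sparsely that no
    support meets two of them.  Each of these blocks is small for the first
    submeasure, hence for every [mu n]; their union is then just as small for
    every [mu n], but its column density is [1].

    Finally, if infinitely many blocks are used by [e] in its component [0]
    and not by [e'], the two ideals are not isomorphic
    ([not_isomorphic_Exh_column_density]): under a bijection, such a block
    loses only a negligible part to the much smaller blocks, and what remains
    is spread over larger blocks of [e'], where it is negligible.  Letting a
    set [X] decide which of two blocks goes to each position gives continuum
    many codings. *)

Set Implicit Arguments.
Unset Strict Implicit.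
Unset Printing Implicit Defensive.

Import Order.TTheory GRing.Theory Num.Theory.
Import numFieldNormedType.Exports.

Local Open Scope classical_set_scope.
Local Open Scope ring_scope.
Local Open Scope ereal_scope.

(** * Lower semicontinuous submeasures and their ideals *)

Section Lscsm.
Variable R : realType.
Implicit Types phi psi : set nat -> \bar R.

(** For monotone set functions, the limit in the definition of a lscsm amounts
    to a bound by the values on finite initial segments; this lemma and the
    next give the two directions. *)
Lemma lscsm_le phi : is_lscsm phi ->
  forall A c, (forall n, phi (A `&` `I_n) <= c) -> phi A <= c.
Proof.
move=> h A c hc; have h1 := @lscsm_lsc _ _ h A.
rewrite -(cvg_lim _ h1)//; apply: lime_le; first by apply/cvg_ex; exists (phi A).
exact: nearW.
Qed.

Lemma lscsm_of_le phi :
  (forall A, 0 <= phi A) -> (forall A B, A `<=` B -> phi A <= phi B) ->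
  (forall A B, phi (A `|` B) <= phi A + phi B) -> phi set0 = 0 ->
  (forall n, phi [set n] < +oo) ->
  (forall A c, (forall n, phi (A `&` `I_n) <= c) -> phi A <= c) ->
  is_lscsm phi.
Proof.
move=> h0 h1 h2 h3 h4 h5; split => // A.
have nd : nondecreasing_seq (fun n => phi (A `&` `I_n)).
  move=> m n mn; apply: h1 => k [Ak /= km]; split => //=; exact: leq_trans km mn.
have -> : phi A = ereal_sup (range (fun n => phi (A `&` `I_n))).
  apply/eqP; rewrite eq_le; apply/andP; split.
    by apply: h5 => n; apply: ereal_sup_ubound; exists n.
  by apply: ge_ereal_sup => _ [n _ <-]; apply: h1; exact: subIsetl.
exact: ereal_nondecreasing_cvgn.
Qed.

Lemma lscsm_sup (T : Type) (D : set T) (mu : T -> set nat -> \bar R) :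
  D !=set0 -> (forall t, D t -> is_lscsm (mu t)) ->
  (forall n, ereal_sup [set mu t [set n] | t in D] < +oo) ->
  is_lscsm (fun A => ereal_sup [set mu t A | t in D]).
Proof.
move=> [t0 Dt0] hmu hfin.
have ub A t : D t -> mu t A <= ereal_sup [set mu t A | t in D].
  by move=> Dt; apply: ereal_sup_ubound; exists t.
have ge0 A : 0 <= ereal_sup [set mu t A | t in D].
  by apply: le_trans (ub A t0 Dt0); exact: lscsm_ge0 (hmu _ Dt0) A.
apply: lscsm_of_le => //.
- move=> A B AB; apply: ge_ereal_sup => _ [t Dt <-].
  by apply: le_trans (ub B t Dt); apply: lscsm_mono => //; exact: hmu.
- move=> A B; apply: ge_ereal_sup => _ [t Dt <-].
  apply: le_trans (lscsm_subadd (hmu t Dt) A B) _.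
  by apply: leeD; exact: ub.
- apply/eqP; rewrite eq_le ge0 andbT; apply: ge_ereal_sup => _ [t Dt <-].
  by rewrite lscsm_set0//; exact: hmu.
- move=> A c hc; apply: ge_ereal_sup => _ [t Dt <-].
  apply: (lscsm_le (hmu t Dt)) => n.
  by apply: le_trans (hc n); exact: ub.
Qed.

Lemma ExhP phi : is_lscsm phi -> forall A,
  Exh phi A <-> forall eps : R, (0 < eps)%R ->
                  exists2 F, finite_set F & phi (A `\` F) < eps%:E.
Proof.
move=> h A; rewrite /Exh/= /exh_norm; split=> [h0 eps e0|hA].
  have : ereal_inf [set phi (A `\` F) | F in [set F | finite_set F]] < eps%:E.
    by rewrite h0 lte_fin.
  by move=> /ereal_inf_lt[_ [F fF <-] lt]; exists F.
apply/eqP; rewrite eq_le; apply/andP; split; last first.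
  by apply: le_ereal_inf_tmp => _ [F _ <-]; exact: lscsm_ge0.
apply/lee_addgt0Pr => e e0; rewrite add0e.
have [F fF /ltW lt] := hA e e0.
by apply: le_trans lt; apply: ereal_inf_lbound; exists F.
Qed.

Lemma finite_nat_bound (F : set nat) : finite_set F ->
  exists M, F `<=` `I_M.
Proof.
move=> /finite_fsetP[X ->]; exists (\max_(i <- finmap.enum_fset X) i).+1 => x /= xX.
by rewrite ltnS; exact: (@leq_bigmax_seq _ _ _ id).
Qed.

Lemma sum_expn2 (J n : nat) :
  (\sum_(J <= j < n) (2^-1 : R) ^+ j <= 2 * 2^-1 ^+ J)%R.
Proof.
suff : (\sum_(J <= j < n) (2^-1 : R) ^+ j + 2 * 2^-1 ^+ (maxn J n)
        = 2 * 2^-1 ^+ J)%R.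
  by move=> <-; rewrite lerDl mulr_ge0// exprn_ge0// invr_ge0.
elim: n => [|n ih]; first by rewrite big_geq// add0r maxn0.
have [Jn|nJ] := leqP J n; last by rewrite big_geq// add0r (maxn_idPl _).
rewrite big_nat_recr//= -{}ih (maxn_idPr _) ?(maxn_idPr Jn)//; last exact: leqW.
rewrite -addrA; congr (_ + _)%R; rewrite exprS mulrA divff// mul1r.
by rewrite mulr_natl mulr2n.
Qed.

Lemma expn2_lt (e : R) : (0 < e)%R -> exists J, ((2^-1 : R) ^+ J < e)%R.
Proof.
move=> e0; have h : (fun n => (2^-1 : R) ^+ n)%R @ \oo --> (0 : R)%R.
  by apply: cvg_expr; rewrite ger0_norm ?invr_ge0// invf_lt1// ltr1n.
have [J _ hJ] := cvgr_lt _ h e e0.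
by exists J; apply: hJ => /=.
Qed.

Lemma lscsm_bigcup_nat phi : is_lscsm phi -> forall (A : nat -> set nat) J n,
  phi (\bigcup_(j in [set j | (J <= j < n)%N]) A j)
    <= \sum_(J <= j < n) phi (A j).
Proof.
move=> h A J; elim=> [|n ih].
  rewrite big_geq// (_ : \bigcup_(_ in _) _ = set0) ?lscsm_set0//.
  by rewrite -subset0 => x [j /=]; rewrite ltn0 andbF.
have [Jn|nJ] := leqP J n; last first.
  rewrite big_geq// (_ : \bigcup_(_ in _) _ = set0) ?lscsm_set0//.
  by rewrite -subset0 => x [j /=]; lia.
rewrite big_nat_recr//=.
apply: le_trans (leeD ih (le_refl _)).
apply: le_trans (lscsm_subadd h _ _); apply: lscsm_mono => // x [j /= jn Ax].
have [jn'|jn'] := eqVneq j n; first by right; rewrite -jn'.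
by left; exists j => //=; lia.
Qed.

(** A source of members of the ideal: sets of geometrically decreasing
    submeasure, the [j]-th of which lies beyond [j]. *)
Lemma Exh_bigcup phi (A : nat -> set nat) : is_lscsm phi ->
  (forall j, finite_set (A j)) ->
  (forall j k, A j k -> (j <= k)%N) ->
  (forall j, phi (A j) <= (2^-1 ^+ j)%R%:E) ->
  Exh phi (\bigcup_j A j).
Proof.
move=> h fA hA hphi; apply/(ExhP h) => e e0.
have [J hJ] : exists J, ((2^-1 : R) ^+ J < e / 2)%R by apply: expn2_lt; lra.
exists (\bigcup_(j in `I_J) A j); first exact: bigcup_finite.
apply: (@le_lt_trans _ _ (2 * 2^-1 ^+ J)%R%:E); last by rewrite lte_fin; lra.
apply: (lscsm_le h) => n.
apply: (@le_trans _ _ (\sum_(J <= j < n) phi (A j))).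
  apply: le_trans (lscsm_bigcup_nat h _ _ _); apply: lscsm_mono => // x.
  move=> [[[j _ Ax] nx] /= xn]; exists j => //=; apply/andP; split.
    by rewrite leqNgt; apply/negP => jJ; apply: nx; exists j.
  exact: leq_ltn_trans (hA _ _ Ax) xn.
apply: (@le_trans _ _ (\sum_(J <= j < n) (2^-1 ^+ j)%R%:E)).
  by apply: lee_sum => j _.
by rewrite sumEFin lee_fin sum_expn2.
Qed.

(** Inclusion of ideals forces a quantitative comparison: otherwise, finite
    sets [A j] beyond [j] with [psi (A j) <= 2^-j] and [phi (A j) >= eps] have
    a union in [Exh psi] but not in [Exh phi]. *)
Lemma Exh_comparison phi psi : is_lscsm phi -> is_lscsm psi ->
  Exh psi `<=` Exh phi ->
  forall eps : R, (0 < eps)%R -> exists2 delta : R, (0 < delta)%R &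
    exists m, forall A, finite_set A -> (forall k, A k -> (m <= k)%N) ->
      psi A < delta%:E -> phi A < eps%:E.
Proof.
move=> hphi hpsi sub eps e0; apply: contrapT => hn.
have H : forall j, exists A, [/\ finite_set A, forall k, A k -> (j <= k)%N,
    psi A <= (2^-1 ^+ j)%R%:E & eps%:E <= phi A].
  move=> j; apply: contrapT => hj; apply: hn; exists (2^-1 ^+ j)%R.
    by rewrite exprn_gt0// invr_gt0.
  exists j => A fA Aj psiA; rewrite ltNge; apply/negP => le; apply: hj.
  by exists A; split => //; exact: ltW.
have {H}[A hA] := choice H.
have /sub/(ExhP hphi)/(_ _ e0)[F /finite_nat_bound[M FM]] : Exh psi (\bigcup_j A j).
  by apply: Exh_bigcup => // j; have [] := hA j.
apply/negP; rewrite -leNgt; have [_ AM _ h] := hA M.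
apply: le_trans h _; apply: lscsm_mono => // x Ax; split; first by exists M.
by move=> /FM /=; rewrite ltnNge AM.
Qed.

(** Real-valued finitely additive measures on the subsets of [nat] that are
    concentrated on a finite set. *)
Record fin_additive (m : set nat -> R) : Prop := {
  fadd_ge0 : forall A, (0 <= m A)%R;
  fadd_setU : forall A B, A `&` B = set0 -> (m (A `|` B) = m A + m B)%R;
  fadd_fin : exists n, forall A, m (A `&` `I_n) = m A }.

Lemma fadd_set0 m : fin_additive m -> m set0 = 0%R.
Proof.
move=> h; have := @fadd_setU _ h set0 set0 (setI0 _); rewrite setU0; lra.
Qed.

Lemma fadd_mono m : fin_additive m -> forall A B, A `<=` B -> (m A <= m B)%R.
Proof.
move=> h A B AB; rewrite -(setDUK AB) (fadd_setU h) ?lerDl ?fadd_ge0//.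
by rewrite setDIK.
Qed.

Lemma fadd_subadd m : fin_additive m ->
  forall A B, (m (A `|` B) <= m A + m B)%R.
Proof.
move=> h A B; rewrite -(setDUK (@subsetUl _ A B)) (fadd_setU h) ?setDIK// lerD2l.
by apply: (fadd_mono h) => x [[]].
Qed.

Lemma fadd_lscsm m : fin_additive m -> is_lscsm (fun A => (m A)%:E).
Proof.
move=> h; apply: lscsm_of_le => //=.
- by move=> A; rewrite lee_fin; exact: fadd_ge0.
- by move=> A B AB; rewrite lee_fin; exact: fadd_mono.
- by move=> A B; rewrite -EFinD lee_fin; exact: fadd_subadd.
- by rewrite fadd_set0.
- by move=> n; rewrite ltry.
- by move=> A c hc; have [n <-] := fadd_fin h; exact: hc.
Qed.

Lemma fadd_content m : fin_additive m ->
  exists eta : {content set nat -> \bar R}, forall A, eta A = (m A)%:E.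
Proof.
move=> h.
have h0 A : 0 <= (m A)%:E by rewrite lee_fin; exact: fadd_ge0.
have hadd : measure_function.semi_additive (fun A : set nat => (m A)%:E).
  move=> F n _ tF _; elim: n => [|n ih]; first by rewrite !big_ord0 fadd_set0.
  rewrite !big_ord_recr/= -ih -EFinD (fadd_setU h)//.
  rewrite -bigcup_mkord -subset0 => x [[i /= ltin Fix] Fnx].
  have := tF i n I I (ex_intro _ x (conj Fix Fnx)).
  by move=> ein; rewrite ein ltnn in ltin.
pose c := isContent.Build _ nat R (fun A : set nat => (m A)%:E) h0 hadd.
pose C : {content set nat -> \bar R} := HB.pack (fun A : set nat => (m A)%:E) c.
by exists C.
Qed.

Lemma sup_fadd_lscsm (T : Type) (mu : T -> set nat -> R) (t0 : T) (M : R) :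
  (forall t, fin_additive (mu t)) -> (forall t A, (mu t A <= M)%R) ->
  is_lscsm (fun A => ereal_sup [set (mu t A)%:E | t in [set: T]]).
Proof.
move=> hmu leM.
apply: (@lscsm_sup T setT (fun t A => (mu t A)%:E)); first by exists t0.
  by move=> t _; exact: fadd_lscsm.
move=> n; apply: (@le_lt_trans _ _ M%:E); last exact: ltry.
by apply: ge_ereal_sup => _ [t _ <-]; rewrite lee_fin.
Qed.

Lemma sup_fadd_nonpathological (T : Type) (mu : T -> set nat -> R) :
  (forall t, fin_additive (mu t)) ->
  nonpathological (fun A => ereal_sup [set (mu t A)%:E | t in [set: T]]).
Proof.
move=> hmu A; apply/eqP; rewrite eq_le; apply/andP; split.
  apply: ge_ereal_sup => _ [t _ <-].
  have [eta heta] := fadd_content (hmu t).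
  apply: ereal_sup_ubound; exists eta; last exact: heta.
  by move=> V /=; rewrite heta; apply: ereal_sup_ubound; exists t.
by apply: ge_ereal_sup => _ [eta /= heta <-].
Qed.

End Lscsm.

(** * Densities in a fast growing sequence of blocks *)

(** [block k] is the interval of length [bsize k] starting at [bstart k]; the
    length is [2 ^ k] times the number of points up to [bstart k], included. *)
Fixpoint bstart (k : nat) : nat :=
  if k is k'.+1 then (bstart k' + 2 ^ k' * (bstart k').+1)%N else 0%N.

Definition bsize (k : nat) : nat := (2 ^ k * (bstart k).+1)%N.

Definition block (k : nat) : set nat :=
  [set n | (bstart k <= n < bstart k.+1)%N].

Lemma bstartS k : bstart k.+1 = (bstart k + bsize k)%N.
Proof. by []. Qed.

Lemma bsize_gt0 k : (0 < bsize k)%N.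
Proof. by rewrite muln_gt0 expn_gt0. Qed.

Lemma leq_bstart : {homo bstart : m n / (m <= n)%N}.
Proof.
apply: homo_leq => // [m n q|]; first exact: leq_trans.
by move=> k; rewrite bstartS leq_addr.
Qed.

Lemma bstart_ge k : (k <= bstart k)%N.
Proof. by elim: k => // k ih; have := bsize_gt0 k; rewrite bstartS; lia. Qed.

Lemma finite_block k : finite_set (block k).
Proof.
by apply: (@sub_finite_set _ _ `I_(bstart k.+1)); [move=> n /andP[] |].
Qed.

Section Dens.
Variable R : realType.

(** The uniform probability measure on the [k]-th block. *)
Definition dens (k : nat) (A : set nat) : R :=
  ((\sum_(bstart k <= n < bstart k.+1) (n \in A)%:R) / (bsize k)%:R)%R.

Lemma bsizeR_gt0 k : (0 < (bsize k)%:R :> R)%R.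
Proof. by rewrite ltr0n bsize_gt0. Qed.

Lemma eq_dens k A B : (forall n, block k n -> A n <-> B n) ->
  dens k A = dens k B.
Proof.
move=> AB; congr (_ / _)%R; apply: eq_big_nat => n nk; congr (nat_of_bool _)%:R.
by apply/idP/idP => /set_mem h; apply/mem_set/AB.
Qed.

Lemma dens_set0 k : dens k set0 = 0%R.
Proof. by rewrite /dens big1 ?mul0r// => n _; rewrite in_set0. Qed.

Lemma dens_setT k : dens k setT = 1%R.
Proof.
rewrite /dens (eq_bigr (fun=> 1%R)); last by move=> n _; rewrite in_setT.
by rewrite big_const_nat iter_addr_0 bstartS addKn divff// lt0r_neq0// bsizeR_gt0.
Qed.

Lemma dens_fadd k : fin_additive (dens k).
Proof.
split.
- by move=> A; rewrite /dens divr_ge0// sumr_ge0.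
- move=> A B AB0; rewrite -mulrDl -big_split/=; congr (_ / _)%R.
  apply: eq_bigr => n _; rewrite -natrD; congr (_%:R)%R.
  rewrite in_setU; case: (boolP (n \in A)) => [/set_mem nA|] //=.
  case: (boolP (n \in B)) => // /set_mem nB.
  by have : (A `&` B) n by []; rewrite AB0.
- exists (bstart k.+1) => A; apply: eq_dens => n /andP[_ nk].
  by split=> [[]|An] //; split.
Qed.

Lemma dens_le1 k A : (dens k A <= 1)%R.
Proof. by rewrite -(dens_setT k); apply: fadd_mono => //; exact: dens_fadd. Qed.

(** Counting through an injection [f] into a list. *)
Lemma dens_le_size k (A : set nat) (f : nat -> nat) (s : seq nat) :
  injective f -> (forall n, block k n -> A n -> f n \in s) ->
  (dens k A <= (size s)%:R / (bsize k)%:R)%R.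
Proof.
move=> fi As; rewrite ler_wpM2r ?invr_ge0//.
rewrite -natr_sum ler_nat -big_mkcond/= sum1_count -size_filter.
rewrite -(size_map f); apply: uniq_leq_size.
  by rewrite map_inj_uniq// filter_uniq// iota_uniq.
move=> _ /mapP[n + ->]; rewrite mem_filter mem_index_iota => /andP[/set_mem An nk].
exact: As.
Qed.

Lemma dens_set1_le k j n : (bstart j <= n)%N ->
  (dens k [set n] <= 2^-1 ^+ j)%R.
Proof.
move=> jn; have [nk|nk] := pselect (block k n); last first.
  rewrite (@eq_dens k _ set0) ?dens_set0 ?exprn_ge0 ?invr_ge0//.
  by move=> m mk; split=> // /= mn; apply: nk; rewrite -mn.
apply: (@le_trans _ _ ((size [:: n])%:R / (bsize k)%:R)%R).
  by apply: (@dens_le_size _ _ id) => // m _ /= ->; rewrite inE.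
have jk : (j <= k)%N.
  rewrite leqNgt; apply/negP => /leq_bstart; case/andP: nk; lia.
rewrite exprVn mul1r lef_pV2 ?posrE ?bsizeR_gt0 ?exprn_gt0//.
rewrite -natrX ler_nat /bsize; apply: (@leq_trans (2 ^ k)).
  by rewrite leq_exp2l.
by rewrite leq_pmulr.
Qed.

End Dens.

(** * The averaged column density *)

(** An injective placement of blocks in the array: [e N i x] is the index of
    the [x]-th block in the column [i] of the component [N].  Only the columns
    [i <= N] matter below, but [e] is total and injective for all indices. *)
Definition coding (e : nat -> nat -> nat -> nat) : Prop :=
  forall N i x N' i' x', e N i x = e N' i' x' -> [/\ N = N', i = i' & x = x'].

Section ColumnSubmeasure.
Variables (R : realType) (e : nat -> nat -> nat -> nat).

(** The mean over the columns of the component [N] of the density in the block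
    selected by [x] in each of them. *)
Definition colavg (N : nat) (x : nat -> nat) (A : set nat) : R :=
  ((\sum_(i < N.+1) dens R (e N i (x i)) A) / N.+1%:R)%R.

(** The submeasure of the construction.  Taking the supremum over the selections
    [x] outside the mean is the same as taking it inside, column by column. *)
Definition column_density (A : set nat) : \bar R :=
  ereal_sup [set (colavg t.1 t.2 A)%:E | t in [set: nat * (nat -> nat)]].

Lemma avg_le N (F : 'I_N.+1 -> R) c :
  (forall i, F i <= c)%R -> ((\sum_(i < N.+1) F i) / N.+1%:R <= c)%R.
Proof.
move=> Fc; rewrite ler_pdivrMr ?ltr0n//.
apply: (@le_trans _ _ (\sum_(i < N.+1) c)%R); first exact: ler_sum.
by rewrite sumr_const card_ord mulr_natr.
Qed.

Lemma colavg_fadd N x : fin_additive (colavg N x).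
Proof.
split.
- move=> A; rewrite divr_ge0// sumr_ge0// => i _.
  exact: fadd_ge0 (dens_fadd _ _) _.
- move=> A B AB; rewrite -mulrDl -big_split/=; congr (_ / _)%R.
  by apply: eq_bigr => i _; rewrite (fadd_setU (dens_fadd _ _)).
- exists (\max_(i < N.+1) bstart (e N i (x i)).+1)%N => A.
  congr (_ / _)%R; apply: eq_bigr => i _; apply: eq_dens => n /andP[_ ni].
  split=> [[]//|An]; split => //=; apply: leq_trans ni _.
  exact: (bigop.bigmax_sup i).
Qed.

Lemma colavg_le1 N x A : (colavg N x A <= 1)%R.
Proof. by apply: avg_le => i; exact: dens_le1. Qed.

Lemma column_density_lscsm : is_lscsm column_density.
Proof.
apply: (@sup_fadd_lscsm _ _ (fun t => colavg t.1 t.2) (0%N, id) 1).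
  by move=> t; exact: colavg_fadd.
by move=> t A; exact: colavg_le1.
Qed.

Lemma column_density_nonpathological : nonpathological column_density.
Proof.
by apply: (@sup_fadd_nonpathological _ _ (fun t => colavg t.1 t.2)) => t;
  exact: colavg_fadd.
Qed.

Lemma colavg_le_column_density N x A : (colavg N x A)%:E <= column_density A.
Proof. by apply: ereal_sup_ubound; exists (N, x). Qed.

Lemma column_density_le A c :
  (forall N x, (colavg N x A <= c)%R) -> column_density A <= c%:E.
Proof. by move=> h; apply: ge_ereal_sup => _ [t _ <-]; rewrite lee_fin. Qed.

Lemma dens_le_column_density x A : (dens R (e 0 0 x) A)%:E <= column_density A.
Proof.
apply: le_trans (colavg_le_column_density 0 (fun=> x) A).
by rewrite /colavg big_ord1 divr1.
Qed.

Lemma column_density_set1_le j n : (bstart j <= n)%N ->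
  column_density [set n] <= (2^-1 ^+ j)%R%:E.
Proof.
by move=> jn; apply: column_density_le => N x; apply: avg_le => i; exact: dens_set1_le.
Qed.

Lemma tall_Exh_column_density : tall (Exh column_density).
Proof.
move=> A infA.
have H : forall j, exists n, A n /\ (bstart j <= n)%N.
  move=> j; apply: contrapT => h; apply: infA.
  apply: (@sub_finite_set _ _ `I_(bstart j)) => // n An /=.
  by rewrite ltnNge; apply/negP => jn; apply: h; exists n.
have {H}[u hu] := choice H.
have uj j : (j <= u j)%N := leq_trans (bstart_ge j) (hu j).2.
exists (\bigcup_j [set u j]); split.
- by move=> _ [j _ ->]; exact: (hu j).1.
- move=> /finite_nat_bound[M hM].
  by have := hM (u M) (ex_intro2 _ _ M I erefl) => /=; rewrite ltnNge uj.
- apply: Exh_bigcup; first exact: column_density_lscsm.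
  + by move=> j; exact: finite_set1.
  + by move=> j k /= ->.
  + by move=> j; apply: column_density_set1_le; exact: (hu j).2.
Qed.

Hypothesis ce : coding e.

Lemma coding_unbounded N i (S : set nat) M : infinite_set S ->
  exists2 x, S x & (M <= e N i x)%N.
Proof.
move=> infS; apply: contrapT => h; apply: infS.
apply: (@sub_finite_set _ _ (e N i @^-1` `I_M)).
  by move=> x Sx /=; rewrite ltnNge; apply/negP => Mx; apply: h; exists x.
by apply: finite_preimage => // x y _ _ /ce[].
Qed.

(** The component [0] has a single column, on which [column_density] dominates
    the densities of the blocks. *)
Lemma not_Exh_column_density (S A : set nat) : infinite_set S ->
  (forall x, S x -> 2^-1 <= dens R (e 0 0 x) A)%R -> ~ Exh column_density A.
Proof.
move=> infS SA /(ExhP column_density_lscsm)/(_ 2^-1%R).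
have -> : (0 < 2^-1 :> R)%R by rewrite invr_gt0.
move=> /(_ isT)[F /finite_nat_bound[M FM]]; apply/negP; rewrite -leNgt.
have [x Sx Mx] := coding_unbounded 0 0 M infS.
apply: le_trans (dens_le_column_density x _); rewrite lee_fin.
rewrite (@eq_dens R _ _ A) ?SA// => n /andP[xn _].
split=> [[]//|An]; split => // /FM /=.
by apply/negP; rewrite -leqNgt (leq_trans Mx)// (leq_trans (bstart_ge _)).
Qed.

Lemma ideal_Exh_column_density : is_ideal (Exh column_density).
Proof.
have h := column_density_lscsm; split.
- move=> A B /(ExhP h) hB AB; apply/(ExhP h) => eps /hB[F fF lt].
  by exists F => //; apply: le_lt_trans lt; apply: (lscsm_mono h); exact: setSD.
- move=> A B /(ExhP h) hA /(ExhP h) hB; apply/(ExhP h) => eps e0.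
  have e2 : (0 < eps / 2)%R by rewrite divr_gt0.
  have [F fF ltF] := hA _ e2; have [G fG ltG] := hB _ e2.
  exists (F `|` G); first by rewrite finite_setU.
  rewrite [eps]splitr EFinD; apply: le_lt_trans (lteD ltF ltG).
  apply: le_trans (lscsm_subadd h _ _); apply: (lscsm_mono h).
  by move=> x [[Ax|Bx] nFG]; [left|right]; split => // ?; apply: nFG; [left|right].
- move=> A fA; apply/(ExhP h) => eps e0; exists A => //.
  by rewrite setDv lscsm_set0// lte_fin.
- apply: (@not_Exh_column_density setT); first exact: infinite_nat.
  by move=> x _; rewrite dens_setT invf_le1// ler1n.
Qed.

End ColumnSubmeasure.

(** * Density-likeness *)

Section DensityLike.
Variables (R : realType) (e : nat -> nat -> nat -> nat).

(** The density of [A] in the column [i] of the component [N]. *)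
Definition coldens (A : set nat) (N i : nat) : R :=
  sup (range (fun x => dens R (e N i x) A)).

Lemma has_sup_coldens A N i : has_sup (range (fun x => dens R (e N i x) A)).
Proof.
split; first by exists (dens R (e N i 0) A), 0%N.
by exists 1%R => _ [x _ <-]; exact: dens_le1.
Qed.

Lemma dens_le_coldens A N i x : (dens R (e N i x) A <= coldens A N i)%R.
Proof. by apply: sup_ubound; [case: (has_sup_coldens A N i)|exists x]. Qed.

Lemma coldens_itv A N i : (0 <= coldens A N i <= 1)%R.
Proof.
apply/andP; split.
  by apply: le_trans (dens_le_coldens A N i 0); exact: fadd_ge0 (dens_fadd _ _) _.
apply: ge_sup; first by case: (has_sup_coldens A N i).
by move=> _ [x _ <-]; exact: dens_le1.
Qed.

Lemma avg_coldens_le A N (c : R) : column_density R e A <= c%:E ->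
  ((\sum_(i < N.+1) coldens A N i) / N.+1%:R <= c)%R.
Proof.
move=> Ac; apply/ler_addgt0Pr => r r0.
have H i : exists x, (coldens A N i - r <= dens R (e N i x) A)%R.
  have [_ [x _ <-] h] := sup_adherent r0 (has_sup_coldens A N i).
  by exists x; exact: ltW.
have [x hx] := choice H.
have : (colavg R e N x A <= c)%R.
  by rewrite -lee_fin; apply: le_trans Ac; exact: colavg_le_column_density.
rewrite /colavg !ler_pdivrMr ?ltr0n// mulrDl => h.
apply: le_trans (lerD h (le_refl _)).
rewrite -lerBlDr.
have : (\sum_(i < N.+1) (coldens A N i - r) <=
        \sum_(i < N.+1) dens R (e N i (x i)) A)%R.
  by apply: ler_sum => i _; exact: hx.
by rewrite sumrB sumr_const card_ord mulr_natr.
Qed.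

Lemma disjoint_near (F : nat -> set nat) M :
  (forall m n, m <> n -> F m `&` F n = set0) ->
  \forall k \near \oo, forall n, F k n -> (M <= n)%N.
Proof.
move=> dF; elim: M => [|M ih]; first exact: nearW.
have hM : \forall k \near \oo, ~ F k M.
  have [[k0 hk0]|h] := pselect (exists k, F k M); last first.
    by apply: nearW => k hk; apply: h; exists k.
  exists k0.+1 => // k /= k0k hk.
  have : (F k0 `&` F k) M by [].
  by rewrite dF// => kk; rewrite kk ltnn in k0k.
near=> k => n Fn; have h : (M <= n)%N by move: n Fn; near: k.
rewrite ltn_neqAle h andbT; apply/eqP => Mn.
by have : ~ F k M; [near: k | rewrite Mn].
Unshelve. all: by end_near. Qed.

(** The limit [a] of [u] along [U], stated through the two bounds in use. *)
Lemma ultra_bounded_limit (U : set_system nat) (u : nat -> R) :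
  UltraFilter U -> (forall k, 0 <= u k <= 1)%R ->
  exists2 a : R, (0 <= a)%R & forall r, (0 < r)%R ->
    (\forall k \near U, u k < a + r)%R /\ (\forall k \near U, a - r <= u k)%R.
Proof.
move=> UU hu; pose C : set R := [set c | \forall k \near U, (u k < c)%R].
have C0 : lbound C 0%R.
  move=> c /filter_ex[k uk]; have /andP[uk0 _] := hu k.
  exact: le_trans uk0 (ltW uk).
have infC : has_inf C.
  split; last by exists 0%R.
  exists 2%R; apply: nearW => k; have /andP[_ uk1] := hu k.
  by apply: le_lt_trans uk1 _; rewrite ltr1n.
exists (inf C); first by apply: lb_le_inf => //; exact: infC.1.
move=> r r0; split.
  have [c Cc cr] := inf_adherent r0 infC.
  by apply: filterS Cc => k uk; exact: lt_trans cr.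
have [h|h] := in_ultra_setVsetC [set k | (u k < inf C - r)%R] UU.
  have : (inf C <= inf C - r)%R by apply: inf_lbound => //; exact: infC.2.
  lra.
by apply: filterS h => k /= /negP; rewrite -leNgt.
Qed.

Hypothesis ce : coding e.

(** The component of a block can be read off its index. *)
Lemma coding_component_bound : exists c : nat -> nat,
  forall N i x, c (e N i x) = N.
Proof.
have H k : exists N, forall N' i x, e N' i x = k -> N' = N.
  have [[N [i [x <-]]]|h] := pselect (exists N i x, e N i x = k).
    by exists N => N' i' x' /ce[].
  by exists 0%N => N i x h'; exfalso; apply: h; exists N, i, x.
by have [c hc] := choice H; exists c => N i x; exact: esym (hc _ N i x erefl).
Qed.

Lemma density_like_column_density : density_like (column_density R e).
Proof.
move=> eps eps0; pose d : R := (eps / 5)%R.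
have d0 : (0 < d)%R by rewrite divr_gt0.
exists d => // F F0 fF dF Fd.
have [U [UU ooU]] := ultraFilterLemma eventually_filter.
have H (t : nat * nat) := ultra_bounded_limit UU
  (fun k => coldens_itv (F k) t.1 t.2).
have [a' ha'] : exists a' : nat * nat -> R, forall t, (0 <= a' t)%R /\
    forall r, (0 < r)%R ->
    (\forall k \near U, coldens (F k) t.1 t.2 < a' t + r)%R /\
    (\forall k \near U, a' t - r <= coldens (F k) t.1 t.2)%R.
  have H' t : exists a, (0 <= a)%R /\ forall r, (0 < r)%R ->
      (\forall k \near U, coldens (F k) t.1 t.2 < a + r)%R /\
      (\forall k \near U, a - r <= coldens (F k) t.1 t.2)%R.
    by have [a a0 ha] := H t; exists a.
  by have [a ha] := choice H'; exists a.
pose a N i := a' (N, i).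
have a0 N i : (0 <= a N i)%R := (ha' (N, i)).1.
have alt N i : (\forall k \near U, coldens (F k) N i < a N i + d)%R :=
  ((ha' (N, i)).2 _ d0).1.
have agt N i : (\forall k \near U, a N i - d <= coldens (F k) N i)%R :=
  ((ha' (N, i)).2 _ d0).2.
have avgF k N : ((\sum_(i < N.+1) coldens (F k) N i) / N.+1%:R <= d)%R.
  by apply: avg_coldens_le; exact: ltW.
have avga N : ((\sum_(i < N.+1) a N i) / N.+1%:R <= d + d)%R.
  have : \forall k \near U, forall i : 'I_N.+1, (a N i - d <= coldens (F k) N i)%R.
    by apply: filter_forall => i; exact: agt.
  move=> /filter_ex[k hk]; rewrite -lerBlDr; apply: le_trans (avgF k N).
  rewrite !ler_pdivlMr ?ltr0n// mulrBl -mulrA mulVf ?pnatr_eq0// mulr1.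
  apply: le_trans (ler_sum _ (fun i _ => hk i)).
  by rewrite sumrB sumr_const card_ord mulr_natr.
have [c hc] := coding_component_bound.
(* [g b] is a term of the sequence beyond the first [b] blocks, with column
     densities under control in every component owning one of these blocks. *)
have Hg b : exists k, (forall (k' : 'I_b) (i : 'I_(c k').+1),
      coldens (F k) (c k') i < a (c k') i + d)%R /\
    (forall n, F k n -> (bstart b <= n)%N).
  apply: (@filter_ex _ U); apply: filterI.
    by apply: filter_forall => k'; apply: filter_forall => i; exact: alt.
  by apply: ooU; exact: disjoint_near.
have [g hg] := choice Hg.
have [bd hbd] := choice (fun k => finite_nat_bound (fF k)).
(* The chosen term [F (kk j)] lies in the blocks of index in [B j, B j.+1). *)
pose fix B j := if j is j'.+1 then maxn (B j') (bd (g (B j'))) else 0%N.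
pose kk j := g (B j).
have Bmono : {homo B : i j / (i <= j)%N}.
  apply: homo_leq => // [m n q|j]; first exact: leq_trans.
  by rewrite /= leq_maxl.
have FB j n : F (kk j) n -> (bstart (B j) <= n < bstart (B j.+1))%N.
  move=> Fn; apply/andP; split; first exact: (hg (B j)).2.
  apply: (leq_trans (hbd _ _ Fn)); apply: leq_trans (bstart_ge _) _.
  by apply: leq_bstart; rewrite /= leq_maxr.
have kkinj : injective kk.
  have lt i j : (i < j)%N -> kk i <> kk j.
    move=> ij kij; have [y Fy] := F0 (kk i).
    have /andP[_ h1] := FB _ _ Fy; rewrite kij in Fy.
    have /andP[h2 _] := FB _ _ Fy; have := leq_bstart (Bmono _ _ ij); lia.
  by move=> i j ij; have [/lt/(_ ij)|/lt/(_ (esym ij))|] := ltngtP i j.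
exists (range kk).
  move=> fk; apply: infinite_nat.
  have -> : [set: nat] = kk @^-1` (range kk).
    by apply/seteqP; split => // j _; exists j.
  by apply: finite_preimage => // i j _ _; exact: kkinj.
set V := \bigcup_(i in range kk) F i.
have densV b : dens R b V = 0%R \/
    exists2 j, (B j <= b < B j.+1)%N & dens R b V = dens R b (F (kk j)).
  have loc j n : block b n -> F (kk j) n -> (B j <= b < B j.+1)%N.
    move=> /andP[bn nb] /FB/andP[jn nj]; apply/andP; split.
      rewrite leqNgt; apply/negP => /leq_bstart; lia.
    rewrite ltnNge; apply/negP => /leq_bstart; lia.
  have [[j jb]|h] := pselect (exists j, (B j <= b < B j.+1)%N); last first.
    left; rewrite -(dens_set0 R b); apply: eq_dens => n nb; split=> //.
    by move=> [_ [j _ <-] Fn]; apply: h; exists j; exact: loc nb Fn.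
  right; exists j => //; apply: eq_dens => n nb; split; last first.
    by move=> Fn; exists (kk j) => //; exists j.
  move=> [_ [j' _ <-] Fn]; have := loc _ _ nb Fn.
  have [j'j|jj'|<- //] := ltngtP j' j.
    have := Bmono _ _ j'j; lia.
  have := Bmono _ _ jj'; lia.
apply: (@le_lt_trans _ _ (4 * d)%:E); last by rewrite lte_fin /d; lra.
apply: column_density_le => N x.
pose P j := [exists i : 'I_N.+1, (B j <= e N i (x i) < B j.+1)%N].
have [exP|nP] := pselect (exists j, P j); last first.
  rewrite /colavg big1 ?mul0r ?mulr_ge0 ?ltW// => i _.
  have [//|[j jb _]] := densV (e N i (x i)).
  by exfalso; apply: nP; exists j; apply/existsP; exists i.
(* [F (kk j0)] is the first chosen term whose range of blocks contains a block
   selected by [x]; later terms are controlled by the limits [a N i]. *)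
have [j0 /existsP[i0 /andP[_ i0j0]] minj0] := ex_minnP exP.
have bound (i : 'I_N.+1) : (dens R (e N i (x i)) V <=
    coldens (F (kk j0)) N i + a N i + d)%R.
  have c0 := andP (coldens_itv (F (kk j0)) N i); have a0i := a0 N i.
  have [->|[j jb ->]] := densV (e N i (x i)); first by case: c0; lra.
  have le1 := dens_le_coldens (F (kk j)) N i (x i).
  have : (j0 <= j)%N by apply: minj0; apply/existsP; exists i.
  rewrite leq_eqVlt => /predU1P[j0j|j0j]; first by move: le1; rewrite -j0j; lra.
  have i0j : (e N i0 (x i0) < B j)%N := leq_trans i0j0 (Bmono _ _ j0j).
  have := (hg (B j)).1 (Ordinal i0j) => /=; rewrite hc => /(_ i).
  rewrite -/(kk j); case: c0; lra.
apply: (@le_trans _ _ ((\sum_(i < N.+1)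
    (coldens (F (kk j0)) N i + a N i + d)) / N.+1%:R)%R).
  by rewrite ler_wpM2r ?invr_ge0//; apply: ler_sum => i _; exact: bound.
rewrite 2!big_split/= 2!mulrDl sumr_const card_ord.
rewrite -[(d *+ _)%R]mulr_natr mulfK ?pnatr_eq0//.
set p := (X in (X + _ + _ <= _)%R); set q := (X in (_ + X + _ <= _)%R).
have : (p <= d)%R := avgF (kk j0) N.
have : (q <= d + d)%R := avga N.
lra.
Qed.

End DensityLike.

(** * Not a generalized density ideal *)

Lemma block_disjoint k k' n : block k n -> block k' n -> k = k'.
Proof.
move=> /andP[h1 h2] /andP[h3 h4]; apply/eqP; rewrite eqn_leq.
apply/andP; split; rewrite leqNgt; apply/negP => /leq_bstart; lia.
Qed.

Section NotGeneralizedDensity.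
Variable R : realType.

Lemma lscsm_setI_supp (mu : set nat -> \bar R) A : is_lscsm mu ->
  mu A <= mu (A `&` supp mu).
Proof.
move=> h; have z : mu (A `\` supp mu) <= 0.
  apply: (lscsm_le h); elim => [|n ih].
    by rewrite (_ : `I_0 = set0) ?setI0 ?lscsm_set0// -subset0 => ?.
  rewrite IIS setIUr; apply: le_trans (lscsm_subadd h _ _) _.
  rewrite -[leRHS](adde0 0); apply: leeD => //.
  have [[_ nn]|nA] := pselect ((A `\` supp mu) n).
    have <- : mu [set n] = 0 by apply: contrapT.
    by apply: lscsm_mono => //; exact: subIsetr.
  rewrite (_ : _ `&` _ = set0) ?lscsm_set0// -subset0 => k [kA /= kn].
  by apply: nA; rewrite -kn.
rewrite -[leRHS]adde0; apply: le_trans (leeD (le_refl _) z).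
apply: le_trans (lscsm_subadd h _ _); apply: lscsm_mono => // x Ax.
by have [?|?] := pselect (supp mu x); [left|right].
Qed.

Section DisjointSupports.
Variable mu : nat -> set nat -> \bar R.
Hypothesis hmu : forall n, is_lscsm (mu n).
Hypothesis fin_mu : forall n, finite_set (supp (mu n)).
Hypothesis disj_mu : forall m n, m <> n -> supp (mu m) `&` supp (mu n) = set0.

Lemma disjoint_supp_eq k m n : supp (mu m) k -> supp (mu n) k -> m = n.
Proof.
move=> mk nk; apply: contrapT => /disj_mu mn.
by have : (supp (mu m) `&` supp (mu n)) k by []; rewrite mn.
Qed.

Lemma disjoint_supp_lscsm :
  is_lscsm (fun A => ereal_sup [set mu n A | n in [set: nat]]).
Proof.
apply: lscsm_sup => //.
move=> k; have [[n0 n0k]|nk] := pselect (exists n, supp (mu n) k); last first.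
  apply: (@le_lt_trans _ _ 0); last by rewrite ltry.
  apply: ge_ereal_sup => _ [n _ <-]; rewrite le_eqVlt; apply/orP; left.
  by apply/eqP; apply: contrapT => h; apply: nk; exists n.
apply: le_lt_trans (lscsm_fin1 (hmu n0) k).
apply: ge_ereal_sup => _ [n _ <-].
have [->|/eqP nn0] := eqVneq n n0; first exact: le_refl.
have -> : mu n [set k] = 0.
  by apply: contrapT => h; apply: nn0; exact: disjoint_supp_eq h n0k.
exact: lscsm_ge0.
Qed.

(** The supports that meet the first [M] points are uniformly bounded. *)
Lemma disjoint_supp_bound M : exists G, forall n k, (k < M)%N ->
  supp (mu n) k -> supp (mu n) `<=` `I_G.
Proof.
have H : forall k, exists g, forall n, supp (mu n) k -> supp (mu n) `<=` `I_g.
  move=> k; have [[n0 n0k]|nk] := pselect (exists n, supp (mu n) k); last first.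
    by exists 0%N => n h; exfalso; apply: nk; exists n.
  have [g hg] := finite_nat_bound (fin_mu n0).
  by exists g => n h; rewrite (disjoint_supp_eq h n0k).
have [g hg] := choice H; exists (\max_(k < M) g k)%N => n k kM nk l nl /=.
apply: leq_trans (hg k n nk l nl) _.
exact: (@bigop.bigmax_sup _ (Ordinal kM)).
Qed.

End DisjointSupports.

Variable e : nat -> nat -> nat -> nat.
Hypothesis ce : coding e.

(** A single block meets one column out of the [N + 1] of its component. *)
Lemma column_density_block_le N (i : 'I_N.+1) y :
  column_density R e (block (e N i y)) <= (N.+1%:R^-1)%R%:E.
Proof.
apply: column_density_le => N' x.
have z k : k <> e N i y -> dens R k (block (e N i y)) = 0%R.
  move=> kN; rewrite -(dens_set0 R k); apply: eq_dens => n kn; split=> // h.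
  by apply: kN; exact: block_disjoint kn h.
have [NN|NN] := eqVneq N' N; last first.
  rewrite /colavg big1 ?mul0r ?invr_ge0// => j _; apply: z => /ce[h _ _].
  by rewrite h eqxx in NN.
subst N'; rewrite /colavg (bigD1 i)//= big1 ?addr0.
  by rewrite ler_pdivrMr ?ltr0n// mulVf ?pnatr_eq0// dens_le1.
move=> j ji; apply: z => /ce[_ h _].
by move: ji; rewrite -val_eqE/= h eqxx.
Qed.

Lemma not_generalized_density_Exh_column_density :
  ~ generalized_density_ideal R (Exh (column_density R e)).
Proof.
move=> [mu [hmu fin_mu disj_mu eqE]].
pose psi (A : set nat) := ereal_sup [set mu n A | n in [set: nat]].
have hpsi : is_lscsm psi by exact: disjoint_supp_lscsm.
have hphi := column_density_lscsm R e.
have [d1 d10 [m1 hm1]] : exists2 d : R, (0 < d)%R & exists m, forall A,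
    finite_set A -> (forall k, A k -> (m <= k)%N) ->
    psi A < d%:E -> column_density R e A < 1%:E.
  by apply: Exh_comparison => //; rewrite eqE.
have [d2 d20 [m2 hm2]] : exists2 d : R, (0 < d)%R & exists m, forall A,
    finite_set A -> (forall k, A k -> (m <= k)%N) ->
    column_density R e A < d%:E -> psi A < (d1 / 2)%:E.
  by apply: Exh_comparison => //; [rewrite eqE | rewrite divr_gt0].
have [N hN] : exists N : nat, (N.+1%:R^-1 < d2)%R.
  have [N _ hN] := near_infty_natSinv_lt (PosNum d20).
  by exists N; apply: hN => /=.
have [G hG] := choice (disjoint_supp_bound fin_mu disj_mu).
have hX (i : nat) : exists Xi : nat -> nat, forall M, (M <= e N i (Xi M))%N.
  have H M : exists x, (M <= e N i x)%N.
    by have [x _ hx] := coding_unbounded ce N i M infinite_nat; exists x.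
  by have [Xi hXi] := choice H; exists Xi.
have {hX}[X hX] := choice hX.
(* The block of index [k i] starts beyond [M i], and [M i.+1] bounds all the
   supports that meet an earlier block. *)
pose fix M i := if i is i'.+1 then
  maxn (M i') (G (bstart (e N i' (X i' (M i'))).+1)) else maxn m1 m2.
pose k i := e N i (X i (M i)).
have Mmono : {homo M : i j / (i <= j)%N}.
  apply: homo_leq => // [m n q|i]; first exact: leq_trans.
  by rewrite /= leq_maxl.
have blockM i n : block (k i) n -> (M i <= n)%N.
  move=> /andP[h _]; apply: leq_trans h; apply: leq_trans (bstart_ge _).
  exact: hX.
have blockm i n : block (k i) n -> (m1 <= n)%N /\ (m2 <= n)%N.
  move=> /blockM h; have : (M 0 <= n)%N by apply: leq_trans h; exact: Mmono.
  by rewrite /= geq_max => /andP.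
have sep i j n : (i < j)%N -> block (k i) `&` supp (mu n) !=set0 ->
    block (k j) `&` supp (mu n) !=set0 -> False.
  move=> ij [a [/andP[_ ai] an]] [b [/blockM bj bn]].
  have /= := hG (bstart (k i).+1) n a ai an b bn.
  have := Mmono _ _ ij; rewrite /= -/(k i); lia.
pose A := \bigcup_(i in `I_N.+1) block (k i).
have fA : finite_set A.
  by apply: bigcup_finite => // i _; exact: finite_block.
have psik i : (i < N.+1)%N -> psi (block (k i)) < (d1 / 2)%:E.
  move=> iN; apply: hm2; first exact: finite_block.
    by move=> n /blockm[].
  apply: le_lt_trans (column_density_block_le (Ordinal iN) _) _.
  by rewrite lte_fin.
have psiA : psi A < d1%:E.
  apply: (@le_lt_trans _ _ (d1 / 2)%:E); last by rewrite lte_fin; lra.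
  apply: ge_ereal_sup => _ [n _ <-].
  apply: le_trans (lscsm_setI_supp _ (hmu n)) _.
  have [[i iN im]|nm] := pselect (exists2 i, (i < N.+1)%N &
      block (k i) `&` supp (mu n) !=set0).
    apply: le_trans (ltW (psik i iN)).
    apply: (@le_trans _ _ (mu n (block (k i)))).
      apply: (lscsm_mono (hmu n)) => a [[j jN aj] an].
      have jm : block (k j) `&` supp (mu n) !=set0 by exists a.
      have [ij|ji|->//] := ltngtP i j; first by case: (sep _ _ _ ij im jm).
      by case: (sep _ _ _ ji jm im).
    by apply: ereal_sup_ubound; exists n.
  rewrite (_ : A `&` _ = set0) ?lscsm_set0 ?lee_fin ?divr_ge0 ?ltW//.
  rewrite -subset0 => a [[j jN aj] an]; apply: nm.
  by exists j => //; exists a.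
have : column_density R e A < 1%:E.
  by apply: hm1 => // n [i _ /blockm[]].
apply/negP; rewrite -leNgt.
apply: le_trans (colavg_le_column_density R e N (fun i => X i (M i)) A).
rewrite lee_fin /colavg (eq_bigr (fun=> 1%R)).
  by rewrite sumr_const card_ord divff// pnatr_eq0.
move=> i _; rewrite -(dens_setT R (k i)); apply: eq_dens => n ni; split=> // _.
by exists i => //=.
Qed.

End NotGeneralizedDensity.

(** * Nonisomorphic column ideals *)

Section NotIsomorphic.
Variables (R : realType) (e e' : nat -> nat -> nat -> nat).
Hypothesis ce : coding e.

(** A block [j] of [e] not used by [e'] is trimmed to the points whose preimage
    is at least [bstart j]; this keeps at least half of the block.  The preimage
    of the trimmed block has at most [bsize j] points, none in the blocks before
    [j], so that its density in the blocks of [e'] is at most [2^-j]. *)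
Lemma not_isomorphic_Exh_column_density (S : set nat) : infinite_set S ->
  (forall x, S x -> forall N i y, e' N i y <> e 0%N 0%N x) ->
  ~ isomorphic (Exh (column_density R e)) (Exh (column_density R e')).
Proof.
move=> infS hS [f [g fK gK] iso].
pose A : set nat := [set n | exists2 x, S x &
  block (e 0 0 x) n /\ (bstart (e 0 0 x) <= g n)%N].
pose B j : set nat := [set m | [/\ exists2 x, S x & e 0 0 x = j,
  block j (f m) & (bstart j <= m)%N]].
have fi : injective f := can_inj fK.
have gi : injective g := can_inj gK.
apply: (@not_Exh_column_density R e ce S A) => // [x Sx|].
  set j := e 0 0 x.
  have h1 : (1 = dens R j A + dens R j (~` A))%R.
    by rewrite -(fadd_setU (dens_fadd _ _)) ?setICr// setUv dens_setT.
  have h2 : (dens R j (~` A) <= 2^-1)%R.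
    apply: (@le_trans _ _ ((size (iota 0 (bstart j)))%:R / (bsize j)%:R)%R).
      apply: (@dens_le_size _ _ _ g) => // n nj nA; rewrite mem_iota add0n /=.
      by rewrite ltnNge; apply/negP => h; apply: nA; exists x.
    rewrite size_iota ler_pdivrMr ?bsizeR_gt0//.
    rewrite mulrC ler_pdivlMr// -natrM ler_nat /bsize.
    case: (j) => [|j'] //; rewrite expnS; have := expn_gt0 2 j'; nia.
  lra.
apply/iso; have -> : f @^-1` A = \bigcup_j B j.
  apply/seteqP; split=> m /=.
    move=> [x Sx [xm]]; rewrite fK => h.
    by exists (e 0 0 x) => //; split => //; exists x.
  by move=> [j _ [[x Sx <-] xm h]]; exists x; rewrite ?fK.
apply: Exh_bigcup; first exact: column_density_lscsm.
- move=> j; apply: (@sub_finite_set _ _ (f @^-1` block j)); first by move=> m [].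
  by apply: finite_preimage; [move=> ? ? _ _ /fi | exact: finite_block].
- by move=> j m [_ _]; apply: leq_trans (bstart_ge _).
move=> j; apply: column_density_le => N y; apply: avg_le => i.
set m := e' _ _ _.
have [mj|jm] := ltnP m j.
  rewrite (@eq_dens R _ _ set0) ?dens_set0 ?exprn_ge0 ?invr_ge0//.
  move=> n /andP[_ nm]; split => // -[_ _ jn].
  by have := leq_bstart mj; lia.
have [[x Sx xj]|nS] := pselect (exists2 x, S x & e 0 0 x = j); last first.
  rewrite (@eq_dens R _ _ set0) ?dens_set0 ?exprn_ge0 ?invr_ge0//.
  by move=> n _; split => // -[].
have {}jm : (j < m)%N.
  rewrite ltn_neqAle jm andbT; apply/eqP => jm'.
  by apply: (hS x Sx N i (y i)); rewrite xj.
apply: (@le_trans _ _ ((size (iota (bstart j) (bsize j)))%:R / (bsize m)%:R)%R).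
  by apply: (@dens_le_size _ _ _ f) => // n _ [_ + _]; rewrite mem_iota -bstartS.
rewrite size_iota ler_pdivrMr ?bsizeR_gt0// exprVn mulrC ler_pdivlMr ?exprn_gt0//.
rewrite -natrX -natrM ler_nat /bsize -/(bsize j).
have h1 : (bsize j <= bstart m)%N.
  by apply: leq_trans (leq_bstart jm); rewrite bstartS leq_addl.
have h2 : (2 ^ j <= 2 ^ m)%N by rewrite leq_exp2l// ltnW.
by rewrite mulnC; apply: leq_mul => //; exact: leqW.
Qed.

End NotIsomorphic.

(** * The family *)

(** The coding attached to [X]: at each position of the array the truth value
    of [X (logn 2 x)] selects one of two blocks.  Every number is [logn 2 x]
    for infinitely many [x], so codings of distinct sets differ at infinitely
    many positions of the column [(0, 0)]. *)
Definition set_coding (X : set nat) (N i x : nat) : nat :=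
  pickle (N, i, x, `[< X (logn 2 x) >]).

Lemma coding_set_coding X : coding (set_coding X).
Proof. by move=> N i x N' i' x' /(pcan_inj pickleK)[-> -> ->]. Qed.

Lemma infinite_logn2 u : infinite_set [set x | logn 2 x = u].
Proof.
move=> /finite_nat_bound[M hM].
have /hM /= : [set x | logn 2 x = u] (2 ^ u * 3 ^ M)%N.
  by rewrite /= lognM ?expn_gt0// !lognX/= muln1 muln0 addn0.
apply/negP; rewrite -leqNgt; apply: (@leq_trans (3 ^ M)).
  exact: ltnW (ltn_expl M _).
by rewrite leq_pmull// expn_gt0.
Qed.

Lemma set_coding_not_isomorphic (R : realType) X Y : X <> Y ->
  ~ isomorphic (Exh (column_density R (set_coding X)))
               (Exh (column_density R (set_coding Y))).
Proof.
move=> XY.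
have [u Xu] : exists u, `[< X u >] <> `[< Y u >].
  apply: contrapT => h; apply: XY; apply/seteqP; split=> u Zu;
    have e : `[< X u >] = `[< Y u >] by apply: contrapT => ?; apply: h; exists u.
  - by apply/asboolP; rewrite -e; apply/asboolP.
  - by apply/asboolP; rewrite e; apply/asboolP.
apply: (not_isomorphic_Exh_column_density
          (@coding_set_coding X) (@infinite_logn2 u)).
move=> x /= xu N i y /(pcan_inj pickleK)[_ _ -> h].
by apply: Xu; rewrite -xu h.
Qed.

Lemma isomorphic_refl I : isomorphic I I.
Proof. by exists id => //; exists id. Qed.

Theorem theorem4p24 (R : realType) :
  exists F : set (set (set nat)),
    [/\ (F #= [set: set nat])%card,
        forall I : set (set nat), F I ->
          [/\ is_ideal I, tall I, nonpathological_ideal R I,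
              density_like_ideal R I & ~ generalized_density_ideal R I] &
        forall I J : set (set nat), F I -> F J -> I <> J -> ~ isomorphic I J].
Proof.
exists (range (fun X => Exh (column_density R (set_coding X)))); split.
- apply: inj_card_eq => X Y _ _ XY; apply: contrapT => nXY.
  apply: (@set_coding_not_isomorphic R _ _ nXY).
  by rewrite [X in isomorphic X _]XY; exact: isomorphic_refl.
- move=> _ [X _ <-]; have cX := @coding_set_coding X.
  have lX := column_density_lscsm R (set_coding X).
  split.
  + exact: ideal_Exh_column_density.
  + exact: tall_Exh_column_density.
  + exists (column_density R (set_coding X)); split => //.
    exact: column_density_nonpathological.
  + exists (column_density R (set_coding X)); split => //.
    exact: density_like_column_density.
  + exact: not_generalized_density_Exh_column_density.
- move=> _ _ [X _ <-] [Y _ <-] IJ; apply: set_coding_not_isomorphic => XY.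
  by apply: IJ; rewrite XY.
Qed.
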